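(* Let $K$ be a field of characteristic $p>0$, let $L/K$ be a finite modular normal field extension, and let $\mathrm{HG}(L/K)$ be its Heerma--Galois group. Let $V$ be a $K$-vector space and let $W$ be an $L$-linear subspace of $V_L=L\otimes_K V$. Then the following are equivalent: (i) there exists a $K$-linear subspace $W_0\subset V$ such that $W=L\otimes_K W_0$ (as subspaces of $V_L$); (ii) $W$ is stable under the natural action of $\mathrm{GHA}(L/K)$ on $V_L$; (iii) $W\otimes_L L[\bar X]$ is stable under the natural action of $\mathrm{HG}(L/K)$ on $V_{L[\bar X]}=V_L\otimes_L L[\bar X]=V\otimes_K L[\bar X]$.
   Context: An algebraic extension $L/K$ is modular if it is isomorphic to a tensor product over $K$ of extensions of $K$ generated by one element. The exponent $e$ of $L/K$ is the smallest integer $n\ge 0$ such that $L^{p^n}$ is separable over $K$ (so $e=0$ if $L/K$ is separable). Put $L[\bar X]=L[X]/(X^{p^e})$ and $K[\bar X]=K[X]/(X^{p^e})$, where $\bar X$ is the class of $X$. The Heerma--Galois group is $\mathrm{HG}(L/K)=\operatorname{Aut}(L[\bar X]/K[\bar X])$, the group of $K[\bar X]$-algebra automorphisms of $L[\bar X]$. Its natural action on $V\otimes_K L[\bar X]$ is $\sigma(v\otimes a)=v\otimes\sigma(a)$. Galois--Hopf algebra: fix a decomposition $L=K(\alpha_0)\otimes_K K(\alpha_1)\otimes_K\cdots\otimes_K K(\alpha_m)$ with $\alpha_0$ separable over $K$ and, for $i\ge1$, $\alpha_i$ a $p^{n_i}$-th root of an element $a_i\in K$, with $[K(\alpha_i):K]=p^{n_i}$.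 Let $G=\operatorname{Gal}(K(\alpha_0)/K)$ and let $H_0=K[G]$ be the group Hopf algebra, with basis $D_g$, $g\in G$. For $i\ge 1$ let $H_i$ be the Hopf algebra over $K$ with $K$-basis $D_i^{(k)}$, $0\le k<p^{n_i}$, where $D_i^{(0)}=1$, with multiplication $D_i^{(h)}D_i^{(k)}=\binom{h+k}{h}D_i^{(h+k)}$ if $h+k<p^{n_i}$ and $0$ otherwise, counit $\epsilon(D_i^{(k)})=0$ for $k>0$ and $\epsilon(D_i^{(0)})=1$, and comultiplication $\Delta(D_i^{(k)})=\sum_{h=0}^k D_i^{(h)}\otimes D_i^{(k-h)}$. Then $\mathrm{GHA}(L/K)=H_0\otimes_K H_1\otimes_K\cdots\otimes_K H_m$. It acts on $L$ factor by factor through the fixed decomposition, with $D_i^{(k)}(\alpha_i^l)=\binom{l}{k}\alpha_i^{l-k}$ for $0\le l<p^{n_i}$ and $D_g(\alpha_0)=g(\alpha_0)$ (extended to the $K$-algebra automorphism $g$ of $K(\alpha_0)$). Its natural action on $V_L$ is the action on $L$ tensored with the trivial action on $V$. *)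

(* Defs.v *)
From HB Require Import structures.
From mathcomp Require Import all_boot all_fingroup all_algebra all_field.
From mathcomp Require Import boolp.

Set Implicit Arguments.
Unset Strict Implicit.
Unset Printing Implicit Defensive.

Import GRing.Theory.
Local Open Scope ring_scope.
Local Open Scope quotient_scope.

(* Tensor product of two modules: formal sums of pairs (u, v), two of them    *)
(* being identified when no bilinear map can tell them apart. This is the     *)
(* usual tensor product: see tensor_lift_tens and tensor_lift_unique.         *)
Section Tensor.
Variables (R : comNzRingType) (U V : lmodType R).

Definition formal_eval (T : lmodType R) (f : U -> V -> T) (s : seq (U * V)) : T :=
  \sum_(x <- s) f x.1 x.2.

Definition tensor_eq (s t : seq (U * V)) : bool :=
  `[< forall (T : lmodType R) (f : {bilinear U -> V -> T}),
        formal_eval f s = formal_eval f t >].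

Fact tensor_eq_refl : reflexive tensor_eq.
Proof. by move=> s; apply/asboolP. Qed.

Fact tensor_eq_sym : symmetric tensor_eq.
Proof.
by move=> s t; apply/asboolP/asboolP=> st T f; rewrite (st T f).
Qed.

Fact tensor_eq_trans : transitive tensor_eq.
Proof.
move=> t s u /asboolP st /asboolP tu; apply/asboolP=> T f.
by rewrite (st T f).
Qed.

Canonical tensor_equiv :=
  EquivRel tensor_eq tensor_eq_refl tensor_eq_sym tensor_eq_trans.

Definition tensor : Type := {eq_quot tensor_eq}.

HB.instance Definition _ := Choice.copy tensor {eq_quot tensor_eq}.

Definition formal_tensor (s : seq (U * V)) : tensor := \pi_{eq_quot tensor_eq} s.

Definition tens (u : U) (v : V) : tensor := formal_tensor [:: (u, v)].

Definition tensor_lift (T : lmodType R) (f : {bilinear U -> V -> T})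
  (x : tensor) : T := formal_eval f (generic_quotient.repr (x : {eq_quot tensor_eq})).

Lemma tensor_lift_formal (T : lmodType R) (f : {bilinear U -> V -> T}) s :
  tensor_lift f (formal_tensor s) = formal_eval f s.
Proof.
rewrite /tensor_lift /formal_tensor.
by case: piP => t /eqmodP/asboolP ->.
Qed.

Lemma tensor_ext (x y : tensor) :
  (forall (T : lmodType R) (f : {bilinear U -> V -> T}),
    tensor_lift f x = tensor_lift f y) -> x = y.
Proof.
move=> xy; rewrite -[x]reprK -[y]reprK; apply/eqmodP/asboolP=> T f.
exact: xy.
Qed.

Definition tensor_zero : tensor := formal_tensor [::].
Definition tensor_add (x y : tensor) : tensor :=
  formal_tensor (generic_quotient.repr (x : {eq_quot tensor_eq}) ++ generic_quotient.repr (y : {eq_quot tensor_eq})).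
Definition tensor_scale (a : R) (x : tensor) : tensor :=
  formal_tensor [seq (a *: uv.1, uv.2) | uv <- generic_quotient.repr (x : {eq_quot tensor_eq})].
Definition tensor_opp (x : tensor) : tensor := tensor_scale (-1) x.

Section Lift.
Variables (T : lmodType R) (f : {bilinear U -> V -> T}).

Lemma tensor_lift0 : tensor_lift f tensor_zero = 0.
Proof. by rewrite tensor_lift_formal /formal_eval big_nil. Qed.

Lemma tensor_liftD x y :
  tensor_lift f (tensor_add x y) = tensor_lift f x + tensor_lift f y.
Proof. by rewrite tensor_lift_formal /formal_eval big_cat. Qed.

Lemma tensor_liftZ a x : tensor_lift f (tensor_scale a x) = a *: tensor_lift f x.
Proof.
rewrite tensor_lift_formal /formal_eval big_map scaler_sumr.
by apply: eq_bigr => uv _; rewrite /= linearZl_LR.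
Qed.

Lemma tensor_liftN x : tensor_lift f (tensor_opp x) = - tensor_lift f x.
Proof. by rewrite tensor_liftZ scaleN1r. Qed.

End Lift.

Let tensor_liftE := (tensor_lift0, tensor_liftD, tensor_liftN, tensor_liftZ).

Fact tensor_addA : associative tensor_add.
Proof. by move=> x y z; apply: tensor_ext => T f; rewrite !tensor_liftE addrA. Qed.

Fact tensor_addC : commutative tensor_add.
Proof. by move=> x y; apply: tensor_ext => T f; rewrite !tensor_liftE addrC. Qed.

Fact tensor_add0 : left_id tensor_zero tensor_add.
Proof. by move=> x; apply: tensor_ext => T f; rewrite !tensor_liftE add0r. Qed.

Fact tensor_addN : left_inverse tensor_zero tensor_opp tensor_add.
Proof. by move=> x; apply: tensor_ext => T f; rewrite !tensor_liftE addNr. Qed.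

HB.instance Definition _ := GRing.isZmodule.Build tensor
  tensor_addA tensor_addC tensor_add0 tensor_addN.

Fact tensor_scaleA a b x :
  tensor_scale a (tensor_scale b x) = tensor_scale (a * b) x.
Proof. by apply: tensor_ext => T f; rewrite !tensor_liftE scalerA. Qed.

Fact tensor_scale1 x : tensor_scale 1 x = x.
Proof. by apply: tensor_ext => T f; rewrite !tensor_liftE scale1r. Qed.

Fact tensor_scaleDr a : {morph tensor_scale a : x y / x + y}.
Proof.
by move=> x y; apply: tensor_ext => T f; rewrite !tensor_liftE scalerDr.
Qed.

Fact tensor_scaleDl x : {morph tensor_scale^~ x : a b / a + b}.
Proof.
by move=> a b; apply: tensor_ext => T f; rewrite !tensor_liftE scalerDl.
Qed.

HB.instance Definition _ := GRing.Zmodule_isLmodule.Build R tensor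
  tensor_scaleA tensor_scale1 tensor_scaleDr tensor_scaleDl.

Fact tensor_lift_is_linear (T : lmodType R) (f : {bilinear U -> V -> T}) :
  linear (tensor_lift f).
Proof. by move=> a x y; rewrite tensor_liftD tensor_liftZ. Qed.

HB.instance Definition _ (T : lmodType R) (f : {bilinear U -> V -> T}) :=
  GRing.isLinear.Build R tensor T *:%R (tensor_lift f) (tensor_lift_is_linear f).

Lemma tensor_lift_tens (T : lmodType R) (f : {bilinear U -> V -> T}) u v :
  tensor_lift f (tens u v) = f u v.
Proof. by rewrite tensor_lift_formal /formal_eval big_seq1. Qed.

Fact tens_is_bilinear :
  bilinear_for (GRing.Scale.Law.clone R tensor *:%R _)
               (GRing.Scale.Law.clone R tensor *:%R _) tens.
Proof.
split=> [v a u u' | u a v v']; apply: tensor_ext => T f.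
  rewrite (tensor_lift_is_linear f a) !tensor_lift_tens.
  exact: linearPl.
rewrite (tensor_lift_is_linear f a) !tensor_lift_tens.
exact: linearPr.
Qed.

HB.instance Definition _ := bilinear_isBilinear.Build R U V tensor
  *:%R *:%R tens tens_is_bilinear.

Lemma tensorP (x : tensor) :
  exists s : seq (U * V), x = \sum_(uv <- s) tens uv.1 uv.2.
Proof.
exists (generic_quotient.repr (x : {eq_quot tensor_eq})); apply: tensor_ext => T f.
rewrite [RHS](raddf_sum (tensor_lift f)); apply: eq_bigr => uv _.
by symmetry; exact: tensor_lift_tens.
Qed.

Lemma tensor_lift_unique (T : lmodType R) (f g : {linear tensor -> T}) :
  (forall u v, f (tens u v) = g (tens u v)) -> f =1 g.
Proof.
move=> fg x; have [s ->] := tensorP x; rewrite !linear_sum.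
by apply: eq_bigr.
Qed.

End Tensor.

Global Opaque tensor_lift.

Section TensorMap.
Variables (R : comNzRingType) (U U' V V' : lmodType R).
Variables (f : {linear U -> U'}) (g : {linear V -> V'}).

Definition tens_comp (u : U) (v : V) : tensor U' V' := tens (f u) (g v).

Fact tens_comp_is_bilinear :
  bilinear_for (GRing.Scale.Law.clone R (tensor U' V') *:%R _)
               (GRing.Scale.Law.clone R (tensor U' V') *:%R _) tens_comp.
Proof.
split=> [v a u u' | u a v v']; rewrite /tens_comp linearP.
  by rewrite linearPl.
by rewrite linearPr.
Qed.

HB.instance Definition _ := bilinear_isBilinear.Build R U V (tensor U' V')
  *:%R *:%R tens_comp tens_comp_is_bilinear.

Definition tensor_map : tensor U V -> tensor U' V' := tensor_lift tens_comp.

HB.instance Definition _ := GRing.Linear.on tensor_map.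

Lemma tensor_map_tens u v : tensor_map (tens u v) = tens (f u) (g v).
Proof. exact: tensor_lift_tens. Qed.

Lemma tensor_map_sum (s : seq (U * V)) :
  tensor_map (\sum_(uv <- s) tens uv.1 uv.2) =
  \sum_(uv <- s) tens (f uv.1) (g uv.2).
Proof.
rewrite (linear_sum tensor_map); apply: eq_bigr => uv _.
exact: tensor_map_tens.
Qed.

End TensorMap.

Section BaseChange.
Variables (R : comNzRingType) (A : comAlgType R) (V : lmodType R).

(* An alias of A (x)_R V carrying the A-module structure.                     *)
Definition base_change : Type := tensor A V.

HB.instance Definition _ := GRing.Zmodule.on base_change.

Definition base_scale (a : A) (x : base_change) : base_change :=
  tensor_map (a \*o idfun) idfun x.

Fact base_scaleA a b x : base_scale a (base_scale b x) = base_scale (a * b) x.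
Proof.
pose f := tensor_map (a \*o idfun) (idfun : V -> V).
have [s ->] := tensorP x; rewrite /base_scale !tensor_map_sum (linear_sum f).
by apply: eq_bigr => i _; rewrite [LHS]tensor_map_tens /= mulrA.
Qed.

Fact base_scale1 x : base_scale 1 x = x.
Proof.
have [s ->] := tensorP x; rewrite /base_scale tensor_map_sum.
by apply: eq_bigr => i _; rewrite /= mul1r.
Qed.

Fact base_scaleDr a : {morph base_scale a : x y / x + y}.
Proof. by move=> x y; apply: linearD. Qed.

Fact base_scaleDl x : {morph base_scale^~ x : a b / a + b}.
Proof.
move=> a b; have [s ->] := tensorP x; rewrite /base_scale !tensor_map_sum.
rewrite -big_split; apply: eq_bigr => i _.
by rewrite /= mulrDl linearDl.
Qed.

HB.instance Definition _ := GRing.Zmodule_isLmodule.Build A base_change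
  base_scaleA base_scale1 base_scaleDr base_scaleDl.

Definition btens (a : A) (v : V) : base_change := tens a v.

Lemma base_scale_tens a b v : a *: btens b v = btens (a * b) v.
Proof. exact: tensor_map_tens. Qed.

End BaseChange.

Section ExtendScalars.
Variables (R : comNzRingType) (V : lmodType R).

Definition base_map (A B : comAlgType R) (f : {linear A -> B}) :
  base_change A V -> base_change B V := tensor_map f idfun.

(* The image of A (x) W0 in A (x) V.                                          *)
Definition extend_subspace (A : comAlgType R) (W0 : {pred V}) :
    {pred base_change A V} :=
  [pred x | `[< exists s : seq (A * V), all (fun av => av.2 \in W0) s /\
                  x = \sum_(av <- s) btens av.1 av.2 >]].

(* For an R-algebra morphism f : A -> B, the image of W (x)_A B in            *)
(* (A (x)_R V) (x)_A B, the latter being identified with B (x)_R V through    *)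
(* (a (x) v) (x) b |-> f(a) b (x) v.                                          *)
Definition extend_along (A B : comAlgType R) (f : {lrmorphism A -> B})
    (W : {pred base_change A V}) : {pred base_change B V} :=
  [pred y | `[< exists s : seq (B * base_change A V),
                  all (fun bw => bw.2 \in W) s /\
                  y = \sum_(bw <- s) bw.1 *: base_map f bw.2 >]].

Definition descends (A : comAlgType R) (W : {pred base_change A V}) : Prop :=
  exists2 W0 : {pred V}, GRing.submod_closed W0 & W =i @extend_subspace A W0.

End ExtendScalars.

(* Tensor products of finite families, through their universal property.      *)
Section TensorFamily.
Variables (K : nzRingType) (I : finType) (U : I -> lmodType K).

Definition multilinear (T : lmodType K) (f : (forall i, U i) -> T) : Prop :=
  forall (u : forall i, U i) (i : I) (a : K) (x y : U i),
    f (dfwith u (a *: x + y)) = a *: f (dfwith u x) + f (dfwith u y).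

Definition is_tensor_product (P : lmodType K) (f : (forall i, U i) -> P) : Prop :=
  [/\ multilinear f,
      forall (T : lmodType K) (g : (forall i, U i) -> T), multilinear g ->
        exists h : {linear P -> T}, forall u, h (f u) = g u
    & forall (T : lmodType K) (h h' : {linear P -> T}),
        (forall u, h (f u) = h' (f u)) -> h =1 h'].

End TensorFamily.

Section Extension.
Variables (K : fieldType) (L : fieldExtType K).

Definition is_exponent (p e : nat) : Prop :=
  (forall x : L, separable_element 1 (x ^+ (p ^ e))) /\
  (forall n, (forall x : L, separable_element 1 (x ^+ (p ^ n))) -> (e <= n)%N).

Definition product_map (I : finType) (E : I -> {vspace L})
  (u : forall i, subvs_of (E i)) : L := \prod_i vsval (u i).

Lemma product_map_linear (I : finType) (E : I -> {vspace L})
    (f : I -> {linear L -> L}) :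
  multilinear (fun u : forall i, subvs_of (E i) => \prod_i f i (vsval (u i))).
Proof.
move=> u i a x y.
have split_i (z : subvs_of (E i)) : \prod_j f j (vsval (dfwith u z j)) =
    f i (vsval z) * \prod_(j | j != i) f j (vsval (u j)).
  rewrite (bigD1 i) //= dfwith_in; congr (_ * _); apply: eq_bigr => j ji.
  by rewrite dfwith_out // eq_sym.
by rewrite !split_i !linearP mulrDl scalerAl.
Qed.

(* L is the tensor product of its subfields E i, via multiplication.          *)
Definition internal_tensor (I : finType) (E : I -> {vspace L}) : Prop :=
  is_tensor_product (@product_map I E).

(* Since L / K is finite and the factors of a tensor decomposition embed in   *)
(* L, it suffices to consider finite families of subfields of L.              *)
Definition modular : Prop :=
  exists (n : nat) (x : 'I_n -> L), internal_tensor (fun i => <<1; x i>>%VS).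

(* L[X]/(X^n), as a K-algebra.                                                *)
Definition truncated (n : nat) : Type := {poly %/ ('X^n : {poly L})}.

HB.instance Definition _ n := GRing.ComNzRing.on (truncated n).

Section Truncated.
Variable n : nat.

Definition truncated_scale (a : K) (q : truncated n) : truncated n :=
  qpolyC 'X^n (a%:A) * q.

Fact truncated_scaleA a b q :
  truncated_scale a (truncated_scale b q) = truncated_scale (a * b) q.
Proof. by rewrite /truncated_scale mulrA -!in_algE !rmorphM. Qed.

Fact truncated_scale1 q : truncated_scale 1 q = q.
Proof. by rewrite /truncated_scale -in_algE !rmorph1 mul1r. Qed.

Fact truncated_scaleDr a : {morph truncated_scale a : q r / q + r}.
Proof. by move=> q r; apply: mulrDr. Qed.

Fact truncated_scaleDl q : {morph truncated_scale^~ q : a b / a + b}.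
Proof. by move=> a b; rewrite /truncated_scale -!in_algE !rmorphD mulrDl. Qed.

HB.instance Definition _ := GRing.Zmodule_isLmodule.Build K (truncated n)
  truncated_scaleA truncated_scale1 truncated_scaleDr truncated_scaleDl.

Fact truncated_scaleAl (a : K) (q r : truncated n) : a *: (q * r) = a *: q * r.
Proof. exact: mulrA. Qed.

HB.instance Definition _ := GRing.Lmodule_isLalgebra.Build K (truncated n)
  truncated_scaleAl.

Fact truncated_scaleAr (a : K) (q r : truncated n) : a *: (q * r) = q * (a *: r).
Proof. exact: mulrCA. Qed.

HB.instance Definition _ := GRing.Lalgebra_isAlgebra.Build K (truncated n)
  truncated_scaleAr.

Definition truncated_const (x : L) : truncated n := qpolyC 'X^n x.

Fact truncated_const_zmod : zmod_morphism truncated_const.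
Proof. by move=> x y; apply: rmorphB. Qed.

Fact truncated_const_monoid : monoid_morphism truncated_const.
Proof. by split=> [|x y]; [apply: rmorph1 | apply: rmorphM]. Qed.

Fact truncated_const_scalable : scalable truncated_const.
Proof.
by move=> a x; rewrite -mulr_algl /truncated_const rmorphM.
Qed.

HB.instance Definition _ := GRing.isZmodMorphism.Build L (truncated n)
  truncated_const truncated_const_zmod.
HB.instance Definition _ := GRing.isMonoidMorphism.Build L (truncated n)
  truncated_const truncated_const_monoid.
HB.instance Definition _ := GRing.isScalable.Build K L (truncated n) *:%R
  truncated_const truncated_const_scalable.

Definition truncated_base (q : {poly %/ ('X^n : {poly K})}) : truncated n :=
  in_qpoly 'X^n (map_poly (in_alg L) q).

End Truncated.

(* K[X]/(X^(p^e))-algebra automorphisms are K-algebra automorphisms fixing    *)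
(* the image of K[X]/(X^(p^e)) pointwise.                                     *)
Record heerma_galois (p e : nat) := HeermaGalois {
  hg_fun :> {lrmorphism truncated (p ^ e) -> truncated (p ^ e)};
  hg_bij : bijective hg_fun;
  hg_base : forall q : {poly %/ ('X^(p ^ e) : {poly K})},
    hg_fun (truncated_base q) = truncated_base q
}.

Definition hg_stable (p e : nat) (V : lmodType K) (W : {pred base_change L V}) :=
  let WX := extend_along (@truncated_const (p ^ e)) W in
  forall s : heerma_galois p e, {in WX, forall w, base_map s w \in WX}.

End Extension.

(* A Hopf algebra over K with a finite basis, given by its structure          *)
(* constants in that basis; the antipode is determined by the rest.           *)
Record based_hopf (K : fieldType) := BasedHopf {
  hbasis :> finType;
  hmul : hbasis -> hbasis -> {ffun hbasis -> K};
  hunit : {ffun hbasis -> K};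
  hcounit : hbasis -> K;
  hcomul : hbasis -> {ffun hbasis * hbasis -> K}
}.

(* In mathcomp h * g is the composite g \o h of Galois automorphisms, whence  *)
(* the order of the factors in the product of two basis elements.             *)
Definition galois_hopf (K : fieldType) (G : finGroupType) : based_hopf K :=
  @BasedHopf K G
    (fun g h => [ffun x => (x == h * g)%g%:R])
    [ffun x => (x == 1)%g%:R]
    (fun=> 1)
    (fun g => [ffun xy => (xy == (g, g))%:R]).

Definition divpow_hopf (K : fieldType) (N : nat) : based_hopf K :=
  @BasedHopf K 'I_N
    (fun h k : 'I_N => [ffun l : 'I_N => if (l == h + k :> nat)%N then 'C(h + k, h)%:R else 0])
    [ffun l : 'I_N => (l == 0 :> nat)%N%:R]
    (fun k : 'I_N => (k == 0 :> nat)%N%:R)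
    (fun k : 'I_N => [ffun ij : 'I_N * 'I_N => (ij.1 + ij.2 == k)%N%:R]).

Definition tensor_hopf (K : fieldType) (I : finType) (H : I -> based_hopf K) :
    based_hopf K :=
  @BasedHopf K {dffun forall i, hbasis (H i)}
    (fun b c => [ffun d : {dffun forall i, hbasis (H i)} =>
                   \prod_i hmul (b i) (c i) (d i)])
    [ffun d : {dffun forall i, hbasis (H i)} => \prod_i hunit (H i) (d i)]
    (fun b => \prod_i hcounit (b i))
    (fun b => [ffun cd : {dffun forall i, hbasis (H i)} *
                         {dffun forall i, hbasis (H i)} =>
                 \prod_i hcomul (b i) (cd.1 i, cd.2 i)]).

(* The index None stands for the separable factor K(alpha_0), and Some i for  *)
(* the purely inseparable factor generated by root i.                         *)
Record decomposition (p : nat) (K : fieldType) (L : fieldExtType K) :=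
  Decomposition {
    dec_size : nat;
    dec_sep : L;
    dec_root : 'I_dec_size -> L;
    dec_height : 'I_dec_size -> nat;
    dec_gen := oapp dec_root dec_sep;
    dec_sepP : separable_element 1 dec_sep;
    dec_rootP : forall i, dec_root i ^+ (p ^ dec_height i) \in 1%VS;
    dec_degree : forall i, \dim <<1; dec_root i>> = (p ^ dec_height i)%N;
    dec_tensor : internal_tensor (fun i => <<1; dec_gen i>>%VS)
  }.

Arguments dec_gen [p K L] d u.

Section GaloisHopf.
Variables (p : nat) (K : fieldType) (L : splittingFieldType K).
Variable D : decomposition p L.

(* gal_of <<1; x>> is the group of all K-automorphisms of K(x).               *)
Definition gha_factor (i : option 'I_(dec_size D)) : based_hopf K :=
  match i with
  | None => galois_hopf K (gal_of <<1; dec_sep D>>)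
  | Some j => divpow_hopf K (p ^ dec_height j)
  end.

Definition gha : based_hopf K := tensor_hopf gha_factor.

(* On K(x), where x has degree N over K, this is the K-linear map sending x^l *)
(* to 'C(l, k) x^(l - k) for l < N; see divided_power_exp.                    *)
Definition divided_power (x : L) (k : nat) (y : L) : L :=
  (Fadjoin_poly 1 x y)^`N(k).[x].

Fact divided_power_is_linear x k : linear (divided_power x k).
Proof.
move=> a y z; rewrite /divided_power linearP /= linearP /= !hornerE.
by rewrite mulr_algl.
Qed.

HB.instance Definition _ x k := GRing.isLinear.Build K L L *:%R
  (divided_power x k) (divided_power_is_linear x k).

Lemma divided_power_exp x k l : (l < \dim <<1; x>>)%N ->
  divided_power x k (x ^+ l) = x ^+ (l - k) *+ 'C(l, k).
Proof.
move=> ltl; rewrite /divided_power (@Fadjoin_poly_unique _ _ 1%AS _ 'X^l).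
- by rewrite nderivnXn hornerMn hornerXn.
- by rewrite rpredX // polyOverX.
- by rewrite size_polyXn adjoin_degreeE dimv1 divn1.
by rewrite hornerXn.
Qed.

Definition gha_factor_act (i : option 'I_(dec_size D)) :
    hbasis (gha_factor i) -> {linear L -> L} :=
  match i return hbasis (gha_factor i) -> {linear L -> L} with
  | None => fun g => gal_repr g
  | Some j => fun k => divided_power (dec_root j) (val k)
  end.

(* A tensor product of basis elements maps a product of the x_i in K(alpha_i) *)
(* to the product of their images under the respective factors.               *)
Fact gha_basis_act_key (b : hbasis gha) :
  { f : {linear L -> L} |
    forall u : forall i, subvs_of <<1; dec_gen D i>>,
      f (product_map u) = \prod_i gha_factor_act (b i) (vsval (u i)) }.
Proof.
apply: cid; case: (dec_tensor D) => _ univ _.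
by apply: univ; apply: product_map_linear.
Qed.

Definition gha_basis_act (b : hbasis gha) : 'End(L) :=
  linfun (sval (gha_basis_act_key b)).

Lemma gha_basis_actE b (u : forall i, subvs_of <<1; dec_gen D i>>) :
  gha_basis_act b (product_map u) = \prod_i gha_factor_act (b i) (vsval (u i)).
Proof. by rewrite lfunE /= (svalP (gha_basis_act_key b)). Qed.

Definition gha_act (h : {ffun hbasis gha -> K}) : 'End(L) :=
  \sum_b h b *: gha_basis_act b.

Definition gha_stable (V : lmodType K) (W : {pred base_change L V}) :=
  forall h : {ffun hbasis gha -> K}, {in W, forall w, base_map (gha_act h) w \in W}.

End GaloisHopf.

(* Main.v *)
Require Import Defs.
From HB Require Import structures.
From mathcomp Require Import all_boot all_fingroup all_algebra all_field.
From mathcomp Require Import boolp.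

(** A descended subspace L (x) W0 is stable under every operator that acts on
    the left factor only, so both kinds of stability follow from descent at
    once. For the converses, call a in L a constant of W if s(a) = s(1) a for
    all K-linear s : L -> L such that s (x) id preserves W. Artin's argument on
    vectors of minimal support ([stable_row_span], [descent_criterion]) shows
    that W descends as soon as its constants all lie in K. It remains to find
    enough operators, and the two kinds of stability provide nearly the same
    ones.

    Let L be the tensor product of subfields K(x_i), let q_i be a power of p,
    and suppose that, for 0 < m < q_i, the m-th divided derivative with respect
    to x_i exists as an operator that is linear over the field F_i generated by
    x_i^(q_i) and the other x_j. Then a constant a lies in the field generated
    by all the x_i^(q_i): working in one generator at a time, write
    a = sum_l c_l x_i^l with l < q_i and c_l in F_i; if l = m > 0 is the highest
    exponent that occurs, the m-th derivative sends a to c_m <> 0, although it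
    kills constants ([divided_constant], [mem_adjoin_powers]).

    For the Heerma-Galois group, take q_i = p^(n_i) with n_i the inseparability
    exponent of x_i. The minimal polynomial of x_i is then a polynomial in
    X^(q_i), so x_i |-> x_i + t defines an automorphism whenever t^(q_i) = 0.
    The choice t = X^(p^(e - n_i)) is the reason for truncating at X^(p^e), and
    the coefficients of this automorphism on L are the divided derivatives. This
    covers generators that are neither separable nor purely inseparable. The
    constants lie in the separable closure of K in L; as the automorphisms of
    L / K act on L[X]/(X^(p^e)) as well, the constants are also fixed by them,
    and L / K being normal they are in K ([separable_fixed]).

    For the Galois-Hopf algebra, the divided derivatives of the purely
    inseparable factors are basis elements, so the constants lie in K(alpha_0).
    This is the separable closure of K in L, hence is stable under the
    automorphisms of L, and the group-like elements D_g leave only K. *)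

Set Implicit Arguments.
Unset Strict Implicit.
Unset Printing Implicit Defensive.

Import GRing.Theory.
Local Open Scope ring_scope.

(** * Linear maps acting on the left factor of a tensor product *)

Section BaseMap.
Variables (R : comNzRingType) (V : lmodType R).

Lemma base_change_ind (A : comAlgType R) (P : base_change A V -> Prop) :
  P 0 -> (forall x y, P x -> P y -> P (x + y)) ->
  (forall a v, P (btens a v)) -> forall x, P x.
Proof.
move=> P0 PD Pt x; have [s ->] := tensorP x.
by apply: (big_ind P) => // av _; apply: Pt.
Qed.

Lemma base_map_btens (A B : comAlgType R) (f : {linear A -> B}) a (v : V) :
  base_map f (btens a v) = btens (f a) v.
Proof. exact: tensor_map_tens. Qed.

Lemma base_map0 (A B : comAlgType R) (f : {linear A -> B}) :
  base_map f 0 = 0 :> base_change B V.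
Proof. exact: (raddf0 (tensor_map f (idfun : {linear V -> V}))). Qed.

Lemma base_mapD (A B : comAlgType R) (f : {linear A -> B}) :
  {morph base_map f : x y / x + y >-> x + y :> base_change B V}.
Proof. exact: (raddfD (tensor_map f (idfun : {linear V -> V}))). Qed.

Lemma base_map_sum (A B : comAlgType R) (f : {linear A -> B}) I (r : seq I)
    (F : I -> base_change A V) :
  base_map f (\sum_(i <- r) F i) = \sum_(i <- r) base_map f (F i).
Proof. exact: (big_morph _ (base_mapD f) (base_map0 f)). Qed.

Lemma base_map_comp (A B C : comAlgType R) (f : {linear A -> B})
    (g : {linear B -> C}) (x : base_change A V) :
  base_map g (base_map f x) = base_map (g \o f) x.
Proof.
elim/base_change_ind: x => [|x y IHx IHy|a v]; first by rewrite !base_map0.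
  by rewrite !base_mapD IHx IHy.
by rewrite !base_map_btens.
Qed.

Lemma eq_base_map (A B : comAlgType R) (f g : {linear A -> B})
    (x : base_change A V) : f =1 g -> base_map f x = base_map g x.
Proof.
move=> fg; elim/base_change_ind: x => [|x y IHx IHy|a v].
- by rewrite !base_map0.
- by rewrite !base_mapD IHx IHy.
by rewrite !base_map_btens fg.
Qed.

Lemma btensDl (A : comAlgType R) (a b : A) (v : V) :
  btens (a + b) v = btens a v + btens b v.
Proof. exact: linearDl. Qed.

Lemma btensDr (A : comAlgType R) (a : A) (v w : V) :
  btens a (v + w) = btens a v + btens a w.
Proof. exact: linearDr. Qed.

Lemma btensZ (A : comAlgType R) (a : A) k (v : V) :
  btens (k *: a) v = btens a (k *: v).
Proof. by rewrite /btens linearZr_LR; exact: linearZl_LR. Qed.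

Lemma btens_sumr (A : comAlgType R) (a : A) I (r : seq I) (F : I -> V) :
  btens a (\sum_(i <- r) F i) = \sum_(i <- r) btens a (F i).
Proof.
apply: (big_morph (fun v => btens a v)); first exact: btensDr.
by apply: (addrI (btens a 0)); rewrite -btensDr !addr0.
Qed.

Lemma extend_subspace_base_map (A B : comAlgType R) (f : {linear A -> B})
    (W0 : {pred V}) (x : base_change A V) :
  x \in @extend_subspace R V A W0 ->
  base_map f x \in @extend_subspace R V B W0.
Proof.
move=> /asboolP[s [sW ->]]; apply/asboolP.
exists [seq (f av.1, av.2) | av <- s]; split; first by rewrite all_map.
by rewrite base_map_sum big_map; apply: eq_bigr => av _; rewrite base_map_btens.
Qed.

End BaseMap.

(** * Descent from operators without non-trivial constants *)

Section Artin.
Variables (K : fieldType) (L : fieldExtType K).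

(** Artin's argument, in coordinates. Below every nonzero vector of M there is a
    nonzero vector of M with entries in K: scale a vector of minimal support so
    that one entry is 1; as every s in S kills 1, applying s entrywise shrinks
    the support and hence gives 0, so all the entries are constants.
    Subtracting a multiple of such a vector removes an entry of the support,
    which makes induction on the support possible. *)
Lemma stable_row_span n (M : {pred 'rV[L]_n}) (S : {linear L -> L} -> Prop) :
    GRing.submod_closed M ->
    (forall s : {linear L -> L}, S s ->
       s 1 = 0 /\ {in M, forall u, map_mx s u \in M}) ->
    (forall a, (forall s, S s -> s a = 0) -> a \in 1%VS) ->
  {in M, forall u, exists s : seq (L * 'rV[K]_n),
     all (fun ck => map_mx (in_alg L) ck.2 \in M) s /\
     u = \sum_(ck <- s) ck.1 *: map_mx (in_alg L) ck.2}.
Proof.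
move=> [M0 MP] stabM constS.
pose supp (u : 'rV[L]_n) := [set i | u 0 i != 0].
have MB c u v : u \in M -> v \in M -> u - c *: v \in M.
  by move=> uM vM; rewrite addrC -scaleNr; apply: MP.
have MZ c u : u \in M -> c *: u \in M.
  by move=> uM; rewrite -[c *: u]addr0; apply: MP.
(* The support shrinks under S until some vector is killed by all of S. *)
have rational u : u \in M -> u != 0 -> exists2 k : 'rV[K]_n,
    map_mx (in_alg L) k \in M & exists2 i, i \in supp u &
      k 0 i = 1 /\ supp (map_mx (in_alg L) k) \subset supp u.
  have [m] := ubnP #|supp u|; elim: m u => // m IHm u ltm uM u_neq0.
  have [i iu] : exists i, i \in supp u.
    apply/set0Pn; apply: contraNneq u_neq0 => su0.
    apply/eqP/rowP => i; rewrite mxE.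
    by have := in_set0 i; rewrite -su0 inE => /negbFE/eqP.
  have ui : u 0 i != 0 by move: iu; rewrite inE.
  pose w := (u 0 i)^-1 *: u.
  have wM : w \in M by apply: MZ.
  have w1 : w 0 i = 1 by rewrite mxE mulVf.
  have supp_w : supp w \subset supp u.
    by apply/subsetP => j; rewrite !inE mxE mulf_eq0 negb_or => /andP[].
  have [[s Ss sw]|] :=
      pselect (exists2 s : {linear L -> L}, S s & map_mx s w != 0).
    have [s1 sM] := stabM s Ss.
    have sub : supp (map_mx s w) \subset supp u :\ i.
      apply/subsetP => j; rewrite 3!inE mxE => sj.
      have -> /= : j != i by apply: contraNneq sj => ->; rewrite w1 s1.
      apply: (subsetP supp_w); rewrite inE; apply: contraNneq sj => ->.
      by rewrite raddf0.
    case: (IHm (map_mx s w)) => //; [|exact: sM|move=> k kM [j jw [kj ksub]]].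
      apply: leq_ltn_trans (subset_leq_card sub) _.
      by move: ltm; rewrite (cardsD1 i) iu.
    have subu := subset_trans sub (subsetDl _ _).
    exists k => //; exists j; first exact: (subsetP subu).
    by split=> //; apply: subset_trans subu.
  move=> noS.
  have w_rat j : exists k : K, w 0 j = k%:A.
    suff /vlineP[k ->] : w 0 j \in 1%VS by exists k.
    apply: constS => s Ss; apply/eqP; apply: contra_notT noS => sj.
    exists s => //; apply: contraNneq sj => sw.
    by have /rowP/(_ j) := sw; rewrite [LHS]mxE [RHS]mxE => ->.
  have [kf kfE] := boolp.choice w_rat; pose k := \row_j kf j.
  have wk : map_mx (in_alg L) k = w.
    by apply/rowP => j; rewrite [LHS]mxE mxE kfE.
  exists k; rewrite wk //; exists i => //; split=> //.
  by have := w1; rewrite -wk mxE => /eqP; rewrite fmorph_eq1 => /eqP.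
move=> u; have [m] := ubnP #|supp u|; elim: m u => // m IHm u ltm uM.
have [->|u_neq0] := eqVneq u 0; first by exists [::]; rewrite big_nil.
have [k kM [i iu [ki ksub]]] := rational u uM u_neq0.
pose v := u - u 0 i *: map_mx (in_alg L) k.
have [||s [sM vE]] := IHm v; last first.
- exists ((u 0 i, k) :: s); rewrite /= kM; split=> //.
  by rewrite big_cons -vE addrC subrK.
- exact: MB.
have sub : supp v \subset supp u :\ i.
  apply/subsetP => j; rewrite 3!inE !mxE => vj; apply/andP; split.
    by apply: contraNneq vj => ->; rewrite ki rmorph1 mulr1 subrr.
  rewrite inE; apply: contraNneq vj => uj.
  have: map_mx (in_alg L) k 0 j = 0.
    apply/eqP; apply: contraTT (introT eqP uj) => kj.
    by have := subsetP ksub j; rewrite !inE => /(_ kj).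
  by rewrite mxE uj => ->; rewrite mulr0 subrr.
apply: leq_ltn_trans (subset_leq_card sub) _.
by move: ltm; rewrite (cardsD1 i) iu.
Qed.

End Artin.

Section Descent.
Variables (K : fieldType) (L : fieldExtType K) (V : lmodType K).
Variable W : {pred base_change L V}.
Hypothesis subW : GRing.submod_closed W.

Definition preserves (s : {linear L -> L}) :=
  {in W, forall w, base_map s w \in W}.

(** An element of W involves finitely many vectors v_i of V, and the rows (l_i)
    such that the sum of the l_i (x) v_i is in W form a stable subspace of L^n.
    Linear relations between the v_i are harmless, since stability and descent
    only concern the vectors of V_L that the rows describe. *)
Lemma descent_criterion :
    (forall a, (forall s : {linear L -> L}, preserves s -> s a = s 1 * a) ->
       a \in 1%VS) -> descends W.
Proof.
move=> constS; have [W0 WP] := subW.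
have WD x y : x \in W -> y \in W -> x + y \in W.
  by move=> xW yW; rewrite -[x]scale1r; apply: WP.
have WZ c x : x \in W -> c *: x \in W.
  by move=> xW; rewrite -[c *: x]addr0; apply: WP.
have Wsum I (r : seq I) (P : pred I) (F : I -> base_change L V) :
    (forall i, P i -> F i \in W) -> \sum_(i <- r | P i) F i \in W.
  by move=> FW; apply: (big_ind (fun x => x \in W)).
pose W1 : {pred V} := fun v => btens 1 v \in W.
have inW1 v : (v \in W1) = (btens 1 v \in W) by [].
exists W1.
  split; first by rewrite inW1 -[0](big_nil 0 +%R xpredT id) btens_sumr big_nil.
  move=> k u v; rewrite !inW1 => uW vW; rewrite btensDr -btensZ.
  by rewrite -[_ *: 1]mulr1 -base_scale_tens; apply: WP.
move=> w; apply/idP/asboolP; last first.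
  move=> [s [/allP sW ->]]; rewrite big_seq; apply: Wsum => -[a v] /sW /= vW.
  by rewrite -[a]mulr1 -base_scale_tens; apply: WZ.
have [r ->] := tensorP w; rewrite big_tnth => wW.
set n := size r in wW *; set t := in_tuple r in wW *.
pose comb (u : 'rV[L]_n) := \sum_i btens (u 0 i) (tnth t i).2.
have combD u v : comb (u + v) = comb u + comb v.
  by rewrite -big_split; apply: eq_bigr => i _; rewrite mxE btensDl.
have combZ c u : comb (c *: u) = c *: comb u.
  by rewrite scaler_sumr; apply: eq_bigr => i _; rewrite base_scale_tens mxE.
have comb0 : comb 0 = 0 by rewrite -(scale0r (0 : 'rV_n)) combZ scale0r.
have comb_map (s : {linear L -> L}) u : comb (map_mx s u) = base_map s (comb u).
  by rewrite base_map_sum; apply: eq_bigr => i _; rewrite base_map_btens mxE.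
have comb_rat (k : 'rV[K]_n) :
    comb (map_mx (in_alg L) k) = btens 1 (\sum_i k 0 i *: (tnth t i).2).
  by rewrite btens_sumr; apply: eq_bigr => i _; rewrite mxE btensZ.
pose M : {pred 'rV[L]_n} := fun u => comb u \in W.
have inM u : (u \in M) = (comb u \in W) by [].
have [||||s [/allP sM sE]] := @stable_row_span _ _ _ M
    (fun s => preserves s /\ s 1 = 0) _ _ _ (\row_i (tnth t i).1).
- split; first by rewrite inM comb0.
  by move=> c u v; rewrite !inM combD combZ => uM vM; apply: WP.
- move=> s [Ws s1]; split=> // u; rewrite !inM comb_map; exact: Ws.
(* An operator s becomes one that kills 1 after subtracting s(1) id. *)
- move=> a sa; apply: constS => s Ws.
  pose d : {linear L -> L} := s \- (s 1 \*o (idfun : {linear L -> L})).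
  have dE w0 : base_map d w0 = base_map s w0 - s 1 *: w0 :> base_change L V.
    elim/base_change_ind: w0 => [|x y IHx IHy|b v].
    - by rewrite !base_map0 scaler0 subr0.
    - by rewrite !base_mapD IHx IHy scalerDr opprD addrACA.
    rewrite !base_map_btens base_scale_tens -[_ - _]/(_ + _).
    by apply: (canRL (addrK _)); rewrite -btensDl subrK.
  apply/eqP; rewrite -subr_eq0; apply/eqP; apply: (sa d); split.
    move=> w0 w0W; rewrite dE -scaleNr addrC; apply: WP => //; exact: Ws.
  by rewrite /d /= mulr1 subrr.
- by rewrite inM; congr (_ \in W): wW; apply: eq_bigr => i _; rewrite mxE.
exists [seq (ck.1, \sum_i ck.2 0 i *: (tnth t i).2) | ck : L * 'rV[K]_n <- s].
split.
  by rewrite all_map; apply/allP => -[c k] /sM /=; rewrite inM comb_rat inW1.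
rewrite big_map; transitivity (comb (\row_i (tnth t i).1)).
  by apply: eq_bigr => i _; rewrite mxE.
rewrite sE (big_morph comb combD comb0); apply: eq_bigr => -[c k] _ /=.
by rewrite combZ comb_rat base_scale_tens mulr1.
Qed.

Lemma descends_preserves (s : {linear L -> L}) : descends W -> preserves s.
Proof.
move=> [W0 _ WE] w; rewrite !WE; exact: extend_subspace_base_map.
Qed.

End Descent.

(** * Constants of divided derivatives *)

Section Generators.
Variables (K : fieldType) (L : fieldExtType K).

Lemma adjoin_seq_ind (P : L -> Prop) (E : {subfield L}) (rs : seq L) :
    {in E, forall y, P y} -> (forall y z, P y -> P z -> P (y + z)) ->
    (forall y z, P y -> P z -> P (y * z)) -> {in rs, forall x, P x} ->
  {in <<E & rs>>%VS, forall y, P y}.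
Proof.
move=> PE PD PM; elim: rs E PE => [|x rs IHrs] E PE Prs y.
  by rewrite Fadjoin_nil; apply: PE.
rewrite adjoin_cons; apply: (IHrs <<E; x>>%AS); last first.
  by move=> z zrs; apply: Prs; rewrite inE zrs orbT.
move=> _ /Fadjoin_polyP[f fE ->]; rewrite horner_coef.
have Px : P x by apply: Prs; rewrite mem_head.
have P1 : P 1 by apply: PE; rewrite mem1v.
have P0 : P 0 by apply: PE; rewrite mem0v.
apply: (big_ind P) => // i _; apply: (PM) => //; first exact/PE/(polyOverP fE).
by elim: (nat_of_ord i) => // k IHk; rewrite exprS; apply: PM.
Qed.

(** Linear maps out of L are determined by their values on products; comparing
    the identity with a projection onto the generated field shows that this
    field is L. *)
Lemma internal_tensor_gen (I : finType) (x : I -> L) :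
  internal_tensor (fun i => <<1; x i>>%VS) -> <<1 & codom x>>%VS = fullv.
Proof.
case=> _ _ ext; apply/eqP; rewrite eqEsubv subvf; apply/subvP => y _.
have <- : projv <<1 & codom x>> y = y; last exact: memv_proj.
apply: (ext _ (projv <<1 & codom x>>) (idfun : {linear L -> L})) => u /=.
apply: projv_id; apply: rpred_prod => i _.
apply: subvP (subvsP (u i)); apply/FadjoinP; split; first exact: sub1v.
by apply: seqv_sub_adjoin; apply: codom_f.
Qed.

(** Replaces the generators x_i by their powers x_i^(q_i) one after the other.
    The fields E that occur contain x_i^(q_i) and, for each j other than i,
    either x_j or its power, hence lie in the field generated by x_i^(q_i) and
    the other x_j. *)
Lemma mem_adjoin_powers (I : finType) (x : I -> L) (q : I -> nat) (y : L) :
    y \in <<1 & codom x>>%VS ->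
    (forall i (E : {subfield L}),
       (forall c, c \in E ->
          c \in <<1 & (x i ^+ q i)%R :: [seq x j | j in predC1 i]>>%VS) ->
       x i ^+ q i \in E -> y \in <<E; x i>>%VS -> y \in E) ->
  y \in <<1 & codom (fun i => x i ^+ q i)%R>>%VS.
Proof.
move=> y_gen peel.
pose E (s : seq I) :=
  <<1 & codom (fun i => x i ^+ (if i \in s then q i else 1))%R>>%AS.
suff: y \in E (enum I).
  congr (_ \in _); congr <<1 & _>>%VS; apply: eq_codom => i.
  by rewrite mem_enum.
elim: (enum I) => [|i s yE].
  by congr (_ \in _): y_gen; congr <<1 & _>>%VS; apply: eq_codom => i.
have xE : x i ^+ q i \in E (i :: s).
  apply: seqv_sub_adjoin; apply/codomP; exists i.
  by rewrite mem_head.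
apply: (peel i) => //.
  apply: subvP; apply/Fadjoin_seqP; split; first exact: sub1v.
  move=> _ /codomP[j ->]; rewrite inE; have [->|ji] /= := eqVneq j i.
    by apply: seqv_sub_adjoin; rewrite mem_head.
  apply: rpredX; apply: seqv_sub_adjoin; rewrite inE; apply/orP; right.
  by apply/imageP; exists j.
apply: subvP yE; apply/Fadjoin_seqP; split; first exact: sub1v.
move=> _ /codomP[j ->].
have [/eqP->|ji] := boolP (j == i); first by rewrite rpredX // memv_adjoin.
apply: subvP_adjoin; apply: seqv_sub_adjoin; apply/codomP; exists j.
by rewrite inE (negbTE ji).
Qed.

(** As x is a root of X^q - x^q, which is defined over E, the element y is a
    polynomial in x over E of degree less than q. If the degree m is positive,
    D m, the m-th divided derivative with respect to x, sends y to the leading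
    coefficient. *)
Lemma divided_constant (E : {subfield L}) (x y : L) (q : nat)
    (D : nat -> {linear L -> L}) :
    (0 < q)%N -> x ^+ q \in E ->
    (forall c l m, c \in E -> (l < q)%N -> (0 < m < q)%N ->
       D m (c * x ^+ l) = c * x ^+ (l - m) *+ 'C(l, m)) ->
    (forall m, (0 < m < q)%N -> D m y = 0) ->
  y \in <<E; x>>%VS -> y \in E.
Proof.
move=> q_gt0 xqE DE Dy yEx.
pose f := Fadjoin_poly E x y.
have fE : f \is a polyOver E by apply: Fadjoin_polyOver.
have fy : f.[x] = y by apply: Fadjoin_poly_eq.
have szf : (size f <= q)%N.
  apply: leq_trans (size_Fadjoin_poly _ _ _) _.
  rewrite -ltnS -size_minPoly -(size_XnsubC (x ^+ q) q_gt0).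
  apply: dvdp_leq; first by rewrite -size_poly_gt0 size_XnsubC.
  apply: minPoly_dvdp; first by rewrite rpredB ?rpredX ?polyOverX ?polyOverC.
  by rewrite /root !hornerE subrr.
have [sz1|sz_gt1] := leqP (size f) 1.
  by rewrite -fy (size1_polyC sz1) hornerC; apply: (polyOverP fE).
pose m := (size f).-1.
have ltm : (0 < m < q)%N by rewrite /m -ltnS prednK ?sz_gt1 ?(ltnW sz_gt1).
have /eqP := Dy m ltm; rewrite -fy horner_coef linear_sum.
have szm : size f = m.+1 by rewrite /m prednK // ltnW.
rewrite szm big_ord_recr big1 /= => [|l _]; last first.
  rewrite DE ?(polyOverP fE) ?bin_small ?mulr0n //.
  by apply: leq_trans szf; rewrite szm ltnW // ltnS.
rewrite DE ?(polyOverP fE) //; last by case/andP: ltm.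
rewrite binn subnn mulr1 add0r mulr1n -[f`_m]/(lead_coef f) lead_coef_eq0.
by move=> /eqP f0; rewrite f0 size_poly0 in sz_gt1.
Qed.

End Generators.

(** * Separable elements and inseparability exponents *)

Section GaloisDescent.
Variables (K : fieldType) (L : splittingFieldType K).

(** L / K is normal, so the minimal polynomial of x is a product of factors
    X - g(x), here all equal to X - x; being separable, it has degree 1. *)
Lemma separable_fixed (x : L) :
  separable_element 1 x -> (forall g : gal_of {:L}, g x = x) -> x \in 1%VS.
Proof.
move=> sepx fixx.
have nL := normalFieldf 1%AS : normalField 1%AS {:L}.
have [r _ rE] := elimT (normalField_factors (sub1v {:L})) nL x (memvf x).
rewrite -adjoin_deg_eq1 eqn_leq andbT -ltnS -size_minPoly.
move: sepx; rewrite /separable_element rE size_prod_XsubC.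
rewrite -(big_map (fun g : gal_of {:L} => g x) xpredT (fun z => 'X - z%:P)).
rewrite separable_prod_XsubC; case: r {rE} => [|g [|h r]] //=.
by rewrite !fixx mem_head.
Qed.

Lemma gal_separable (h : gal_of {:L}) (y : L) :
  separable_element 1 y -> separable_element 1 (h y).
Proof.
move=> sepy; apply/separable_elementP; exists (minPoly 1 y).
rewrite minPolyOver; split=> //.
apply: (kHom_root_id (K := 1%AS) (E := {:L}%AS)) (memvf y) _ => //.
- exact: sub1v.
- exact: k1AHom.
- exact: minPolyOver.
exact: root_minPoly.
Qed.

End GaloisDescent.

Section InseparabilityExponent.
Variables (K : fieldType) (L : fieldExtType K).

(** Inseparability makes the minimal polynomial of x a polynomial g in X^p. The
    minimal polynomial of x^p divides g, and after substituting X^p for X it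
    also vanishes at x. *)
Lemma minPoly_inseparable p (x : L) :
    p \in [pchar L] -> ~~ separable_element 1 x ->
  minPoly 1 x = minPoly 1 (x ^+ p) \Po 'X^p.
Proof.
move=> charL /separablePn_pchar[p' charL' [g gK gE]].
have ep : p' = p.
  by apply/eqP; move: charL'; rewrite (pcharf_eq charL).
subst p'; have p_prime := pcharf_prime charL.
have comp_poly (h : {poly L}) :
    h \is a polyOver 1%VS -> h \Po 'X^p \is a polyOver 1%VS.
  by move=> hK; rewrite polyOver_comp // polyOverXn.
apply/eqP; rewrite -eqp_monic ?monic_minPoly //; last first.
  rewrite monicE lead_coef_comp ?size_polyXn ?ltnS ?prime_gt0 //.
  by rewrite lead_coefXn expr1n mulr1 -monicE monic_minPoly.
rewrite /eqp; apply/andP; split.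
  apply: minPoly_dvdp; first by rewrite comp_poly ?minPolyOver.
  by rewrite /root horner_comp hornerXn minPolyxx.
rewrite gE; have /dvdpP[u ->]: minPoly 1 (x ^+ p) %| g.
  apply: minPoly_dvdp => //; rewrite /root -[x ^+ p]hornerXn -horner_comp.
  by rewrite -gE minPolyxx.
by rewrite comp_polyM dvdp_mull.
Qed.

Lemma minPoly_separable_exponent p e (x : L) :
    p \in [pchar L] -> separable_element 1 (x ^+ (p ^ e)) ->
  exists2 n, (n <= e)%N & separable_element 1 (x ^+ (p ^ n)) /\
     minPoly 1 x = minPoly 1 (x ^+ (p ^ n)) \Po 'X^(p ^ n).
Proof.
move=> charL; elim: e x => [|e IHe] x sepx.
  by exists 0; rewrite // expn0 expr1 comp_polyXr.
have [sep|insep] := boolP (separable_element 1 x).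
  by exists 0; rewrite // expn0 expr1 comp_polyXr.
have [|n len [sepn nE]] := IHe (x ^+ p); first by rewrite -exprM -expnS.
exists n.+1 => //; rewrite (minPoly_inseparable charL insep) nE expnS exprM.
split=> //.
by rewrite -comp_polyA comp_Xn_poly exprM.
Qed.

End InseparabilityExponent.

(** * Homomorphisms out of a tensor product of simple extensions *)

Section EqHom.
Variables (K : fieldType) (L : fieldExtType K) (A : comAlgType K).

Lemma eq_adjoin_hom (f g : {lrmorphism L -> A}) (rs : seq L) :
  {in rs, f =1 g} -> {in <<1 & rs>>%VS, f =1 g}.
Proof.
move=> fg; apply: (@adjoin_seq_ind _ _ (fun y => f y = g y) 1%AS) => //.
- by move=> _ /vlineP[k ->]; rewrite !rmorph_alg.
- by move=> y z fy fz; rewrite !rmorphD /= fy fz.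
by move=> y z fy fz; rewrite !rmorphM /= fy fz.
Qed.

End EqHom.

Section TensorHom.
Variables (K : fieldType) (L : fieldExtType K) (I : finType) (x : I -> L).
Hypothesis tensL : internal_tensor (fun i => <<1; x i>>%VS).
Variables (A : comAlgType K) (f : {lrmorphism L -> A}) (y : I -> A).
Hypothesis root_y : forall i, (map_poly f (minPoly 1 (x i))).[y i] = 0.

Definition factor_hom i (u : L) : A :=
  (map_poly f (Fadjoin_poly 1 (x i) u)).[y i].

Fact factor_hom_linear i : linear (factor_hom i).
Proof.
move=> a u v; rewrite /factor_hom linearP /= rmorphD /= map_polyZ /= !hornerE.
by rewrite rmorph_alg mulr_algl.
Qed.

HB.instance Definition _ i := GRing.isLinear.Build K L A *:%R (factor_hom i)
  (factor_hom_linear i).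

Lemma factor_hom_horner i p : p \is a polyOver 1%VS ->
  factor_hom i p.[x i] = (map_poly f p).[y i].
Proof.
move=> pK; rewrite /factor_hom (@Fadjoin_poly_mod _ _ 1%AS) //.
rewrite {2}(divp_eq p (minPoly 1 (x i))) rmorphD rmorphM /= !hornerE.
by rewrite root_y mulr0 add0r.
Qed.

Lemma factor_homM i u v : u \in <<1; x i>>%VS -> v \in <<1; x i>>%VS ->
  factor_hom i (u * v) = factor_hom i u * factor_hom i v.
Proof.
move=> /Fadjoin_polyP[p pK ->] /Fadjoin_polyP[q qK ->].
by rewrite -hornerM !factor_hom_horner ?rpredM // rmorphM hornerM.
Qed.

Lemma factor_hom1 i : factor_hom i 1 = 1.
Proof.
rewrite -(hornerC 1 (x i)) factor_hom_horner ?polyOverC ?mem1v //.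
by rewrite rmorph1 hornerC.
Qed.

Lemma factor_hom_multilinear :
  multilinear (fun u : forall i, subvs_of <<1; x i>>%VS =>
                 \prod_i factor_hom i (vsval (u i))).
Proof.
move=> u i a v w.
have split_i (z : subvs_of <<1; x i>>) :
    \prod_j factor_hom j (vsval (dfwith u z j)) =
    factor_hom i (vsval z) * \prod_(j | j != i) factor_hom j (vsval (u j)).
  rewrite (bigD1 i) //= dfwith_in; congr (_ * _); apply: eq_bigr => j ji.
  by rewrite dfwith_out // eq_sym.
by rewrite !split_i !linearP mulrDl scalerAl.
Qed.

(** The universal property of the tensor product only yields a linear map. It is
    multiplicative on products of elements of the factors, and linear maps that
    agree on products are equal, which is used once in each variable. *)
Lemma tensor_hom : exists g : {lrmorphism L -> A}, forall i, g (x i) = y i.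
Proof.
case: (tensL) => _ univ ext.
have [h hE] := univ A _ factor_hom_multilinear.
pose one i : subvs_of <<1; x i>> := Subvs (mem1v <<1; x i>>%AS).
have h1 : h 1 = 1.
  have -> : 1 = product_map one :> L by rewrite /product_map big1.
  by rewrite hE big1 // => i _; exact: factor_hom1.
have hM : {morph h : a b / a * b}.
  move=> a b.
  apply: (ext _ (h \o (a \*o (idfun : {linear L -> L}))) (h a \*o h)) => u /=.
  rewrite ![_ * product_map u]mulrC ![_ * h (product_map u)]mulrC.
  apply: (ext _ (h \o (product_map u \*o (idfun : {linear L -> L})))
            (h (product_map u) \*o h)) => v /=.
  pose uv i : subvs_of <<1; x i>> :=
    Subvs (rpredM (subvsP (u i)) (subvsP (v i))).
  have -> : product_map u * product_map v = product_map uv.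
    by rewrite /product_map -big_split.
  rewrite !hE -big_split; apply: eq_bigr => i _.
  by rewrite factor_homM ?subvsP.
have lin_h : linear h by move=> k a b; rewrite linearP.
pose g : {lrmorphism L -> A} := HB.pack (h : L -> A)
  (GRing.isMonoidMorphism.Build L A h (conj h1 hM))
  (GRing.isLinear.Build K L A *:%R h lin_h).
exists g => i; rewrite -[g _]/(h _).
pose xi : subvs_of <<1; x i>> := Subvs (memv_adjoin 1%AS (x i)).
have others j z : j != i -> dfwith one (z : subvs_of <<1; x i>>) j = one j.
  by move=> ji; rewrite dfwith_out // eq_sym.
have xE : product_map (dfwith one xi) = x i.
  rewrite /product_map (bigD1 i) //= dfwith_in big1 ?mulr1 // => j ji.
  by rewrite others.
rewrite -[in LHS]xE hE (bigD1 i) //= dfwith_in big1 => [|j ji]; last first.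
  by rewrite others // factor_hom1.
rewrite mulr1 /xi /= -[in LHS](hornerX (x i)) factor_hom_horner ?polyOverX //.
by rewrite map_polyX hornerX.
Qed.

End TensorHom.

(** * Automorphisms of truncated polynomial rings *)

Section Truncated.
Variables (K : fieldType) (L : fieldExtType K) (n : nat).
Notation T := (truncated L n).

Definition tpoly (p : {poly L}) : T := in_qpoly 'X^n p.

Fact tpoly_zmod : zmod_morphism tpoly.
Proof. exact: raddfB (in_qpoly 'X^n). Qed.

Fact tpoly_monoid : monoid_morphism tpoly.
Proof. exact: in_qpoly_monoid_morphism. Qed.

HB.instance Definition _ :=
  GRing.isZmodMorphism.Build {poly L} T tpoly tpoly_zmod.
HB.instance Definition _ :=
  GRing.isMonoidMorphism.Build {poly L} T tpoly tpoly_monoid.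

Definition tcoef (k : nat) (q : T) : L := (val q)`_k.

Lemma tpolyK (q : T) : tpoly (val q) = q.
Proof. by apply: val_inj; apply: in_qpoly_small; apply: size_mk_monic. Qed.

(** For n = 0 the modulus is 'X rather than 1, whence the exponent n.-1.+1. *)
Lemma tpolyXn : tpoly 'X^(n.-1.+1) = 0.
Proof.
apply: val_inj; rewrite /= mk_monic_Xn.
exact: Pdiv.RingMonic.rmodpp (monicXn _ n.-1.+1).
Qed.

Lemma tcoef_tpoly k p : (k < n.-1.+1)%N -> tcoef k (tpoly p) = p`_k.
Proof.
move=> ltk; rewrite /tcoef /= mk_monic_Xn.
rewrite {2}(Pdiv.RingMonic.rdivp_eq (monicXn _ n.-1.+1) p) coefD coefMXn ltk.
by rewrite add0r.
Qed.

Lemma tpolyC a : tpoly a%:P = truncated_const n a.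
Proof.
apply: val_inj; apply: in_qpoly_small.
by rewrite (leq_ltn_trans (size_polyC_leq1 _)) // size_mk_monic_gt1.
Qed.

Lemma tcoefCM k a q : tcoef k (truncated_const n a * q) = a * tcoef k q.
Proof.
have [ltk|gek] := ltnP k n.-1.+1; last first.
  have sz (r : T) : tcoef k r = 0.
    rewrite /tcoef nth_default // -ltnS.
    apply: leq_trans (size_mk_monic r) _.
    by rewrite mk_monic_Xn size_polyXn ltnS.
  by rewrite !sz mulr0.
by rewrite -tpolyC -[q]tpolyK -rmorphM !tcoef_tpoly // coefCM.
Qed.

Fact tcoef_linear k : linear (tcoef k).
Proof.
move=> a q r; rewrite -[a *: q]/(truncated_const n a%:A * q).
have -> : a *: tcoef k q = tcoef k (truncated_const n a%:A * q).
  by rewrite tcoefCM mulr_algl.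
exact: coefD.
Qed.

HB.instance Definition _ k :=
  GRing.isLinear.Build K T L *:%R (tcoef k) (tcoef_linear k).

Lemma tcoef_const a : tcoef 0 (truncated_const n a) = a.
Proof. by rewrite -tpolyC tcoef_tpoly // coefC. Qed.

Lemma horner_const (p : {poly L}) :
  (map_poly (truncated_const n) p).[tpoly 'X] = tpoly p.
Proof.
elim/poly_ind: p => [|p c IHp]; first by rewrite !rmorph0 horner0.
rewrite !rmorphD !rmorphM /= map_polyX map_polyC /= hornerMXaddC IHp.
by rewrite tpolyC.
Qed.

Section Extend.
Variable f : {lrmorphism L -> T}.

(** The K[X]-linear ring endomorphism of L[X]/(X^n) that extends f. *)
Definition textend (q : T) : T := (map_poly f (val q)).[tpoly 'X].

Lemma textend_tpoly p : textend (tpoly p) = (map_poly f p).[tpoly 'X].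
Proof.
rewrite /textend /= mk_monic_Xn.
rewrite {2}(Pdiv.RingMonic.rdivp_eq (monicXn _ n.-1.+1) p).
rewrite rmorphD rmorphM /= map_polyXn hornerD hornerM hornerXn.
by rewrite -rmorphXn /= tpolyXn mulr0 add0r.
Qed.

Fact textend_zmod : zmod_morphism textend.
Proof.
move=> q r; rewrite -[q]tpolyK -[r]tpolyK -rmorphB !textend_tpoly.
by rewrite rmorphB !hornerE.
Qed.

Fact textend_monoid : monoid_morphism textend.
Proof.
split=> [|q r].
  rewrite -[in LHS](rmorph1 tpoly) textend_tpoly !rmorph1.
  by rewrite -polyC1 hornerC.
rewrite -[q]tpolyK -[r]tpolyK -rmorphM !textend_tpoly.
by rewrite rmorphM hornerM.
Qed.

Lemma textend_const a : textend (truncated_const n a) = f a.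
Proof. by rewrite -tpolyC textend_tpoly map_polyC hornerC. Qed.

Lemma textendX : textend (tpoly 'X) = tpoly 'X.
Proof. by rewrite textend_tpoly map_polyX hornerX. Qed.

Fact textend_scalable : scalable textend.
Proof.
move=> a q; rewrite -[a *: q]/(truncated_const n a%:A * q) textend_monoid.2.
by rewrite textend_const rmorph_alg mulr_algl.
Qed.

HB.instance Definition _ :=
  GRing.isZmodMorphism.Build T T textend textend_zmod.
HB.instance Definition _ :=
  GRing.isMonoidMorphism.Build T T textend textend_monoid.
HB.instance Definition _ :=
  GRing.isScalable.Build K T T *:%R textend textend_scalable.

Lemma textend_base q : textend (truncated_base L q) = truncated_base L q.
Proof.
rewrite -[truncated_base L q]/(tpoly _) textend_tpoly -[RHS]horner_const.
rewrite -!map_poly_comp; congr _.[_]; apply: eq_map_poly => a /=.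
by rewrite !rmorph_alg.
Qed.

End Extend.

Lemma textendK (f g : {lrmorphism L -> T}) :
  (forall a, textend f (g a) = truncated_const n a) ->
  cancel (textend g) (textend f).
Proof.
move=> fg q; rewrite -[q]tpolyK textend_tpoly -(horner_map (textend f)) /=.
rewrite textendX -map_poly_comp.
rewrite -[RHS]horner_const; congr _.[_]; apply: eq_map_poly => a /=.
exact: fg.
Qed.

Lemma truncated_automorphism (f g : {lrmorphism L -> T}) :
    (forall a, textend f (g a) = truncated_const n a) ->
    (forall a, textend g (f a) = truncated_const n a) ->
  exists s : {lrmorphism T -> T}, [/\ bijective s,
    forall q, s (truncated_base L q) = truncated_base L q
    & forall a, s (truncated_const n a) = f a].
Proof.
move=> fg gf; exists (textend f); split; last exact: textend_const.
  by exists (textend g); apply: textendK.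
exact: textend_base.
Qed.

End Truncated.

(** * Stability under the Heerma-Galois group *)

Section HeermaGaloisStable.
Variables (K : fieldType) (L : fieldExtType K) (p e : nat).
Variables (V : lmodType K) (W : {pred base_change L V}).
Hypothesis subW : GRing.submod_closed W.
Notation T := (truncated L (p ^ e)).
Notation const := (@truncated_const K L (p ^ e)).

Lemma descends_hg_stable : descends W -> hg_stable p e W.
Proof.
move=> [W0 _ WE] WX s w /asboolP[r [/allP rW ->]]; apply/asboolP.
pose good (y : base_change T V) := exists r' : seq (T * base_change L V),
  all (fun bw => bw.2 \in W) r' /\
  y = \sum_(bw <- r') bw.1 *: base_map const bw.2.
have good0 : good 0 by exists [::]; rewrite big_nil.
have goodD y z : good y -> good z -> good (y + z).
  move=> [a [aW ->]] [b [bW ->]]; exists (a ++ b).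
  by rewrite all_cat aW bW big_cat.
suff: good (base_map s (\sum_(bw <- r) bw.1 *: base_map const bw.2)) by [].
rewrite base_map_sum big_seq; apply: (big_ind good) => // -[b w0] /rW /=.
rewrite WE => /asboolP[t [/allP tW0 ->]].
rewrite [X in _ *: X]base_map_sum scaler_sumr base_map_sum big_seq.
apply: (big_ind good) => // -[a v] /tW0 /= vW0.
exists [:: (s (b * const a), btens 1 v)]; rewrite big_seq1 /= andbT; split.
  by rewrite WE; apply/asboolP; exists [:: (1, v)]; rewrite /= vW0 big_seq1.
rewrite !base_map_btens !base_scale_tens base_map_btens.
by rewrite rmorph1 mulr1.
Qed.

(** The coefficients of the restriction of s to L preserve W, because taking a
    coefficient is L-linear and hence sends the extension of W back to W. *)
Lemma hg_stable_preserves (s : heerma_galois L p e) (k : nat) :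
  hg_stable p e W -> preserves W (@tcoef K L (p ^ e) k \o s \o const).
Proof.
have [W0 WP] := subW; move=> stabW w wW.
have wX : base_map const w \in extend_along const W.
  by apply/asboolP; exists [:: (1, w)]; rewrite /= wW big_seq1 scale1r.
have /asboolP[r [/allP rW]] := stabW s _ wX.
rewrite base_map_comp => /(congr1 (base_map (@tcoef K L (p ^ e) k))).
rewrite base_map_comp base_map_sum => sE.
rewrite (@eq_base_map _ _ _ _ _ (tcoef k \o (s \o const))) // sE.
rewrite big_seq.
apply: (big_ind (fun y => y \in W)) => // [x y xW yW|[b w0] /rW /= w0W].
  by rewrite -[x]scale1r; apply: WP.
suff -> : base_map (tcoef k) (b *: base_map const w0) = tcoef k b *: w0.
  by rewrite -[_ *: _]addr0; apply: WP.
elim/base_change_ind: w0 {w0W} => [|x y IHx IHy|a v].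
- by rewrite base_map0 !scaler0 base_map0.
- by rewrite base_mapD !scalerDr base_mapD IHx IHy.
rewrite base_map_btens !base_scale_tens base_map_btens.
congr btens; rewrite mulrC [RHS]mulrC; exact: tcoefCM.
Qed.

End HeermaGaloisStable.

Section Shift.
Variables (K : fieldType) (L : fieldExtType K) (p e : nat).
Hypothesis charL : p \in [pchar L].
Variables (I : finType) (x : I -> L).
Hypothesis tensL : internal_tensor (fun i => <<1; x i>>%VS).
Notation N := (p ^ e)%N.
Notation T := (truncated L N).
Notation const := (@truncated_const K L N).

Let p_prime : prime p := pcharf_prime charL.
Let N_gt0 : (0 < N)%N. Proof. by rewrite expn_gt0 prime_gt0. Qed.

Definition shifts (g : L -> T) (i : I) (t : T) :=
  forall j, g (x j) = const (x j) + (if j == i then t else 0).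

Lemma tpolyX_nilp n :
  (n <= e)%N -> (tpoly N 'X^(p ^ (e - n)) : T) ^+ (p ^ n) = 0.
Proof.
move=> lene; rewrite -rmorphXn /= -exprM -expnD subnK //.
by have := @tpolyXn K L N; rewrite prednK.
Qed.

Lemma truncated_frobenius n (y z : T) :
  (y + z) ^+ (p ^ n) = y ^+ (p ^ n) + z ^+ (p ^ n).
Proof.
have charT : p \in [pchar T] := rmorph_pchar const charL.
by apply: exprDn_pchar; rewrite (eq_pnat _ (pcharf_eq charT)) pnatX pnat_id.
Qed.

(** The minimal polynomial of x_i is a polynomial in X^(p^n), and x_i + t has
    the same p^n-th power as x_i. *)
Lemma shift_hom i n (t : T) :
    minPoly 1 (x i) = minPoly 1 (x i ^+ (p ^ n)) \Po 'X^(p ^ n) ->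
    t ^+ (p ^ n) = 0 ->
  exists g : {lrmorphism L -> T}, shifts g i t.
Proof.
move=> minPolyE t_nilp; pose f : {lrmorphism L -> T} := const.
apply: (tensor_hom (f := f) tensL) => j; case: eqVneq => [->|_]; last first.
  by rewrite addr0 (horner_map f) minPolyxx rmorph0.
rewrite minPolyE map_comp_poly map_polyXn horner_comp hornerXn.
rewrite truncated_frobenius t_nilp addr0 -(rmorphXn f) (horner_map f) minPolyxx.
exact: rmorph0.
Qed.

Lemma shift_homK i (t : T) (f g : {lrmorphism L -> T}) :
    shifts f i t -> shifts g i (- t) -> textend f t = t ->
  forall a, textend f (g a) = const a.
Proof.
move=> fx gx ft a.
have := @eq_adjoin_hom _ _ _ (textend f \o g) const (codom x).
apply; last by rewrite (internal_tensor_gen tensL) memvf.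
move=> _ /codomP[j ->] /=; rewrite gx rmorphD /= textend_const fx -addrA.
case: eqP => _; last by rewrite rmorph0 !addr0.
by rewrite rmorphN /= ft subrr addr0.
Qed.

Lemma shift_fixes i n (t : T) (g : {lrmorphism L -> T}) :
    t ^+ (p ^ n) = 0 -> shifts g i t ->
  {in <<1 & (x i ^+ (p ^ n))%R :: [seq x j | j in predC1 i]>>%VS,
    forall a, g a = const a}.
Proof.
move=> t_nilp gx; apply: eq_adjoin_hom => a.
rewrite inE => /orP[/eqP->|/imageP[j ji ->]].
  rewrite rmorphXn /= gx eqxx truncated_frobenius t_nilp addr0.
  exact/esym/rmorphXn.
by rewrite gx (negbTE ji) addr0.
Qed.

(** Expand (x_i + X^c)^l: the coefficient of X^(mc) is the m-th divided
    derivative of x_i^l. *)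
Lemma tcoef_shift i c (g : {lrmorphism L -> T}) (a : L) l m :
    (0 < c)%N -> (m * c < N)%N -> shifts g i (tpoly N 'X^c) -> g a = const a ->
  tcoef (m * c) (g (a * x i ^+ l)) = a * x i ^+ (l - m) *+ 'C(l, m).
Proof.
move=> c_gt0 ltmc gx ga.
rewrite rmorphM /= ga tcoefCM rmorphXn /= gx eqxx -mulrnAr; congr (_ * _).
rewrite -tpolyC -rmorphD -rmorphXn tcoef_tpoly; last by rewrite prednK.
rewrite exprDn coef_sum /=.
have coefE k : (((x i)%:P ^+ (l - k) * 'X^c ^+ k) *+ 'C(l, k))`_(m * c)
    = if k == m then x i ^+ (l - m) *+ 'C(l, m) else 0.
  rewrite coefMn -polyC_exp coefCM -exprM coefXn mulnC eqn_pmul2l // eq_sym.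
  by case: eqP => [->|_]; rewrite ?mulr1 // mulr0 mul0rn.
under eq_bigr do rewrite coefE.
have [ltlm|lem] := ltnP l m.
  by rewrite bin_small // mulr0n big1 // => k _; rewrite if_same.
by rewrite -big_mkcond /= (big_pred1 (Ordinal (lem : (m < l.+1)%N))).
Qed.

End Shift.

Section Fixed.
Variables (K : fieldType) (L : splittingFieldType K) (p e : nat).
Hypothesis charL : p \in [pchar L].
Notation N := (p ^ e)%N.
Notation T := (truncated L N).

Lemma heerma_galois_of (f g : {lrmorphism L -> T}) :
    (forall a, textend f (g a) = truncated_const N a) ->
    (forall a, textend g (f a) = truncated_const N a) ->
  exists s : heerma_galois L p e, forall a, s (truncated_const N a) = f a.
Proof.
move=> fg gf; have [s [bij base sE]] := truncated_automorphism fg gf.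
by exists (HeermaGalois bij base).
Qed.

Lemma heerma_galois_gal (h : gal_of {:L}) :
  exists s : heerma_galois L p e,
    forall a, s (truncated_const N a) = truncated_const N (h a).
Proof.
pose f (h : gal_of {:L}) : {lrmorphism L -> T} :=
  @truncated_const K L N \o (gal_repr h : 'AEnd(L)).
have fK h1 h2 a : (h1 * h2)%g = 1%g ->
    textend (f h2) (f h1 a) = truncated_const N a.
  by move=> h12; rewrite textend_const /= -galM ?memvf // h12 gal_id.
have [s sE] := heerma_galois_of (fun a => fK _ _ a (mulVg h))
                                (fun a => fK _ _ a (mulgV h)).
by exists s.
Qed.

(** Invariance under the shifts of the generators by powers of X puts a into the
    field generated by the separable elements x_i^(p^(n_i)); the automorphisms
    of L do the rest. *)
Lemma heerma_galois_fixed (I : finType) (x : I -> L) (a : L) :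
    internal_tensor (fun i => <<1; x i>>%VS) ->
    (forall y : L, separable_element 1 (y ^+ N)) ->
    (forall s : heerma_galois L p e,
       s (truncated_const N a) = truncated_const N a) ->
  a \in 1%VS.
Proof.
move=> tensL expL fix_a.
have p_gt0 : (0 < p)%N by rewrite prime_gt0 // (pcharf_prime charL).
have /boolp.choice[n nE] i : exists n,
    [/\ (n <= e)%N, separable_element 1 (x i ^+ (p ^ n))
      & minPoly 1 (x i) = minPoly 1 (x i ^+ (p ^ n)) \Po 'X^(p ^ n)].
  have [n len [sepn nE]] := minPoly_separable_exponent charL (expL (x i)).
  by exists n.
apply: separable_fixed => [|h]; last first.
  have [s sE] := heerma_galois_gal h.
  by have := fix_a s; rewrite sE => /(congr1 (tcoef 0)); rewrite !tcoef_const.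
have sepE : separable 1 <<1 & codom (fun i => x i ^+ (p ^ n i))%R>>.
  by apply: separable_Fadjoin_seq; apply/allP => _ /codomP[i ->]; case: (nE i).
apply: (separableP sepE); apply: (mem_adjoin_powers (q := fun i => p ^ n i)%N).
  by rewrite (internal_tensor_gen tensL) memvf.
move=> i E EF xE aE; have [len _ mE] := nE i.
(* As c p^(n i) = p^e, the power X^c is killed by raising it to p^(n i), while
   the powers X^(m c) with m < p^(n i) survive the truncation. *)
pose c := (p ^ (e - n i))%N; pose t : T := tpoly N 'X^c.
have c_gt0 : (0 < c)%N by rewrite expn_gt0 p_gt0.
have mc_lt m : (m < p ^ n i)%N -> (m * c < N)%N.
  by move=> ltm; rewrite -(subnKC len) expnD ltn_pmul2r.
have t_nilp : t ^+ (p ^ n i) = 0 := tpolyX_nilp charL len.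
have Nt_nilp : (- t) ^+ (p ^ n i) = 0 by rewrite exprNn t_nilp mulr0.
have ext_t (f : {lrmorphism L -> T}) : textend f t = t.
  by rewrite /t !rmorphXn /= textendX.
have [f fx] := shift_hom charL tensL mE t_nilp.
have [g gx] := shift_hom charL tensL mE Nt_nilp.
have fx' : shifts x f i (- - t) by rewrite opprK.
have ext_Nt : textend g (- t) = - t by rewrite rmorphN /= ext_t.
have [s sE] := heerma_galois_of (shift_homK tensL fx gx (ext_t f))
                                (shift_homK tensL gx fx' ext_Nt).
pose D m : {linear L -> L} := @tcoef K L N (m * c) \o f.
apply: (@divided_constant _ _ E (x i) a (p ^ n i) D) => //.
- by rewrite expn_gt0 p_gt0.
- move=> b l m bE _ /andP[_ ltm]; apply: tcoef_shift => //; first exact: mc_lt.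
  exact: (shift_fixes charL t_nilp fx) (EF b bE).
move=> m /andP[m_gt0 ltm]; rewrite /D /= -sE fix_a -tpolyC tcoef_tpoly.
  by rewrite coefC muln_eq0 !gtn_eqF.
by rewrite prednK ?mc_lt // expn_gt0 p_gt0.
Qed.

Variables (V : lmodType K) (W : {pred base_change L V}).
Hypothesis subW : GRing.submod_closed W.

Lemma hg_stable_descends :
    modular L -> (forall y : L, separable_element 1 (y ^+ N)) ->
  hg_stable p e W -> descends W.
Proof.
move=> [n [x tensL]] expL stabW; apply: descent_criterion => // a aW.
apply: (heerma_galois_fixed tensL expL) => s; apply: val_inj; apply/polyP => k.
have /= := aW _ (hg_stable_preserves subW s k stabW).
by rewrite !rmorph1 mulrC -tcoefCM mulr1.
Qed.

End Fixed.

(** * Stability under the Galois-Hopf algebra *)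

Section GaloisHopfAction.
Variables (p : nat) (K : fieldType) (L : splittingFieldType K).
Hypothesis charL : p \in [pchar L].
Variable D : decomposition p L.

Let p_gt0 : (0 < p)%N := prime_gt0 (pcharf_prime charL).

Lemma height_gt0 (j : 'I_(dec_size D)) : (0 < p ^ dec_height j)%N.
Proof. by rewrite expn_gt0 p_gt0. Qed.

Definition gha_factor_unit (i : option 'I_(dec_size D)) :
    hbasis (gha_factor i) :=
  match i return hbasis (gha_factor i) with
  | None => 1%g
  | Some j => Ordinal (height_gt0 j)
  end.

Lemma gha_factor_unit_act i y : y \in <<1; dec_gen D i>>%VS ->
  gha_factor_act (gha_factor_unit i) y = y.
Proof.
case: i => [j|] yE /=; last exact: gal_id.
by rewrite /divided_power nderivn0 Fadjoin_poly_eq.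
Qed.

Definition gha_single i (c : hbasis (gha_factor i)) : hbasis (gha D) :=
  [ffun j => dfwith gha_factor_unit c j].

Lemma gha_single_act i (c : hbasis (gha_factor i))
    (u : forall j, subvs_of <<1; dec_gen D j>>) :
  gha_basis_act (gha_single c) (product_map u) =
    gha_factor_act c (vsval (u i)) * \prod_(j | j != i) vsval (u j).
Proof.
rewrite gha_basis_actE (bigD1 i) //= ffunE dfwith_in; congr (_ * _).
apply: eq_bigr => j ji; rewrite ffunE dfwith_out 1?eq_sym //.
by rewrite gha_factor_unit_act ?subvsP.
Qed.

Lemma gha_single_factor i (c : hbasis (gha_factor i)) y :
    y \in <<1; dec_gen D i>>%VS ->
  gha_basis_act (gha_single c) y = gha_factor_act c y.
Proof.
move=> yE.
pose one j : subvs_of <<1; dec_gen D j>> := Subvs (mem1v <<1; dec_gen D j>>%AS).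
pose u := dfwith one (Subvs yE : subvs_of <<1; dec_gen D i>>).
have uj j : j != i -> u j = one j by move=> ji; rewrite /u dfwith_out // eq_sym.
have -> : y = product_map u.
  rewrite /product_map (bigD1 i) //= big1 => [|j ji]; last by rewrite uj.
  by rewrite /u dfwith_in mulr1.
rewrite gha_single_act big1 => [|j ji]; last by rewrite uj.
rewrite /product_map (bigD1 i) //= big1 => [|j ji]; last by rewrite uj.
by rewrite !mulr1.
Qed.

Lemma gha_singleMl i j (c : hbasis (gha_factor i)) z y : j != i ->
    z \in <<1; dec_gen D j>>%VS ->
  gha_basis_act (gha_single c) (z * y) = z * gha_basis_act (gha_single c) y.
Proof.
move=> ji zE; set B := gha_basis_act _; case: (dec_tensor D) => _ _ ext.
apply: (ext _ ((B : {linear L -> L}) \o (z \*o (idfun : {linear L -> L})))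
          (z \*o (B : {linear L -> L}))) => u /=.
pose zu : subvs_of <<1; dec_gen D j>> := Subvs (rpredM zE (subvsP (u j))).
pose v := dfwith u zu.
have vk k : k != j -> v k = u k by move=> kj; rewrite /v dfwith_out // eq_sym.
have -> : z * product_map u = product_map v.
  rewrite /product_map (bigD1 j) //= [RHS](bigD1 j) //= mulrA.
  rewrite [v j]dfwith_in /=; congr (_ * _).
  by apply: eq_bigr => k kj; rewrite vk.
rewrite !gha_single_act vk 1?eq_sym // mulrCA; congr (_ * _).
rewrite (bigD1 j) //= [in RHS](bigD1 j) //= mulrA [v j]dfwith_in /=.
by congr (_ * _); apply: eq_bigr => k /andP[_ kj]; rewrite vk.
Qed.

(** Linearity over the field F_i that [divided_constant] asks for: in the purely
    inseparable directions the power x_i^(q_i) is an element w of K. *)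
Lemma gha_single_linear i (c : hbasis (gha_factor i)) w :
    w \in 1%VS ->
  {in <<1 & w :: [seq dec_gen D j | j in predC1 i]>>%VS, forall z y,
     gha_basis_act (gha_single c) (z * y) = z * gha_basis_act (gha_single c) y}.
Proof.
have lin1 z : z \in 1%VS -> forall y,
    gha_basis_act (gha_single c) (z * y) = z * gha_basis_act (gha_single c) y.
  by move=> /vlineP[k ->] y; rewrite !mulr_algl linearZ.
move=> w1; apply: (@adjoin_seq_ind _ _ _ 1%AS) => [|z t zP tP y|z t zP tP y|].
- exact: lin1.
- by rewrite !mulrDl linearD /= zP tP.
- by rewrite -!mulrA zP tP.
move=> z; rewrite inE => /orP[/eqP->|/imageP[j ji ->]]; first exact: lin1.
by move=> y; apply: (gha_singleMl _ _ ji); apply: memv_adjoin.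
Qed.

Lemma purely_inseparable_over_sep (y : L) :
  exists n, y ^+ (p ^ n) \in <<1; dec_sep D>>%VS.
Proof.
have E1 z : z \in 1%VS -> z \in <<1; dec_sep D>>%VS.
  exact: (subvP (sub1v <<1; dec_sep D>>%AS)).
have up n m z : z ^+ (p ^ n) \in <<1; dec_sep D>>%VS ->
    z ^+ (p ^ (n + m)) \in <<1; dec_sep D>>%VS.
  by move=> zn; rewrite expnD exprM rpredX.
have: y \in <<1 & codom (dec_gen D)>>%VS.
  by rewrite (internal_tensor_gen (dec_tensor D)) memvf.
apply: (@adjoin_seq_ind _ _
         (fun y => exists n, y ^+ (p ^ n) \in <<1; dec_sep D>>%VS) 1%AS).
- by move=> z z1; exists 0%N; rewrite expn0 expr1; apply: E1.
- move=> z t [n zn] [m tm]; exists (n + m)%N; rewrite exprDn_pchar.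
    by apply: rpredD; [apply: up | rewrite addnC; apply: up].
  rewrite (eq_pnat _ (pcharf_eq charL)) pnatX.
  by rewrite pnat_id ?(pcharf_prime charL).
- move=> z t [n zn] [m tm]; exists (n + m)%N.
  by rewrite exprMn; apply: rpredM; [apply: up | rewrite addnC; apply: up].
move=> _ /codomP[[j|] ->]; last by exists 0%N; rewrite expr1 memv_adjoin.
by exists (dec_height j); apply: E1; apply: dec_rootP.
Qed.

(** A separable element generates the same field over K(alpha_0) as all its
    p^n-th powers, one of which is in K(alpha_0). *)
Lemma separable_mem_sep (y : L) :
  separable_element 1 y -> y \in <<1; dec_sep D>>%VS.
Proof.
move=> sepy; have [n yn] := purely_inseparable_over_sep y.
have := separable_elementS (sub1v <<1; dec_sep D>>%AS) sepy.
rewrite (pcharf_p_separable _ _ n charL) (Fadjoin_idP _) // expnS mulnC exprM.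
exact: rpredX.
Qed.

(** K(alpha_0), being the separable closure of K in L, is stable under the
    automorphisms of L, which therefore restrict to automorphisms of
    K(alpha_0). *)
Lemma gal_sep_fixed (y : L) : y \in <<1; dec_sep D>>%VS ->
  (forall g : gal_of <<1; dec_sep D>>, g y = y) -> y \in 1%VS.
Proof.
have /separableP sepE : separable 1 <<1; dec_sep D>>.
  by rewrite -adjoin_separable_eq dec_sepP.
move=> yE fixy; apply: separable_fixed (sepE y yE) _ => h.
have hE : ((gal_repr h : 'AEnd(L)) @: <<1; dec_sep D>> <= <<1; dec_sep D>>)%VS.
  apply/subvP => _ /memv_imgP[z zE ->].
  by apply: separable_mem_sep; apply: gal_separable; apply: sepE.
by rewrite -[RHS](fixy (gal _ h)) galK.
Qed.

Variables (V : lmodType K) (W : {pred base_change L V}).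

Lemma gha_stable_preserves (b : hbasis (gha D)) :
  gha_stable D W -> preserves W (gha_basis_act b).
Proof.
move=> stabW w wW.
pose h : {ffun hbasis (gha D) -> K} := [ffun b' => (b' == b)%:R].
have <- : gha_act h = gha_basis_act b; last exact: stabW.
rewrite /gha_act (bigD1 b) //= big1 => [|b' b'b]; last first.
  by rewrite ffunE (negbTE b'b) scale0r.
by rewrite ffunE eqxx scale1r addr0.
Qed.

Lemma gha_stable_descends :
  GRing.submod_closed W -> gha_stable D W -> descends W.
Proof.
move=> subW stabW; apply: descent_criterion => // a aW.
have actP (b : hbasis (gha D)) : gha_basis_act b a = gha_basis_act b 1 * a.
  exact: (aW (gha_basis_act b) (gha_stable_preserves b stabW)).
(* The exponent 1 leaves the separable generator as it is. *)
pose q (i : option 'I_(dec_size D)) := oapp (fun j => p ^ dec_height j)%N 1%N i.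
have q1 i : i != None -> dec_gen D i ^+ q i \in 1%VS.
  by case: i => // j _; apply: dec_rootP.
pose Q : {vspace L} := <<1 & codom (fun i => dec_gen D i ^+ q i)%R>>%VS.
have sQ : (Q <= <<1; dec_sep D>>)%VS.
  apply/Fadjoin_seqP; split; first exact: sub1v.
  move=> _ /codomP[[j|] ->]; last by rewrite expr1 memv_adjoin.
  by apply: (subvP (sub1v <<1; dec_sep D>>%AS)); apply: q1.
have aQ : a \in Q.
  apply: mem_adjoin_powers.
    by rewrite (internal_tensor_gen (dec_tensor D)) memvf.
  case=> [j|] E EF xE; last first.
    by rewrite (Fadjoin_idP _) //; move: xE; rewrite expr1.
  pose B m : {linear L -> L} :=
    if insub m is Some c then gha_basis_act (@gha_single (Some j) c)
    else (\0 : {linear L -> L}).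
  have BE m (ltm : (m < p ^ dec_height j)%N) :
      B m = gha_basis_act (@gha_single (Some j) (Ordinal ltm)).
    by rewrite /B insubT.
  have DE m (ltm : (m < p ^ dec_height j)%N) l : (l < p ^ dec_height j)%N ->
      gha_basis_act (@gha_single (Some j) (Ordinal ltm))
        (dec_gen D (Some j) ^+ l) =
      dec_gen D (Some j) ^+ (l - m) *+ 'C(l, m).
    move=> ltl; rewrite gha_single_factor ?rpredX ?memv_adjoin //=.
    by rewrite divided_power_exp ?dec_degree.
  apply: (@divided_constant _ _ E _ a (q (Some j)) B) => //.
  - exact: height_gt0.
  - move=> c l m cE ltl /andP[_ ltm]; rewrite (BE m ltm) -mulrnAr -DE //.
    by apply: (gha_single_linear _ (q1 (Some j) isT)); apply: EF.
  move=> m /andP[m_gt0 ltm]; rewrite (BE m ltm) /= actP.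
  rewrite -(expr0 (dec_gen D (Some j))) DE ?height_gt0 //.
  by rewrite bin_small // mulr0n mul0r.
have aE := subvP sQ a aQ; apply: (gal_sep_fixed aE) => g.
have := actP (@gha_single None g); rewrite !gha_single_factor ?mem1v //=.
by rewrite rmorph1 mul1r.
Qed.

End GaloisHopfAction.

Theorem theorem2p5 (p : nat) (K : fieldType) (charK : p \in [pchar K])
    (L : splittingFieldType K) (modL : modular L)
    (e : nat) (expL : is_exponent L p e)
    (V : lmodType K) (W : {pred base_change L V})
    (subW : GRing.submod_closed W) :
  (descends W <-> hg_stable p e W) /\
  (forall D : decomposition p L, descends W <-> gha_stable D W).
Proof.
have charL : p \in [pchar L] := rmorph_pchar (in_alg L) charK.
split; [|move=> D]; split.
- exact: descends_hg_stable.
- exact: (hg_stable_descends charL subW modL expL.1).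
- by move=> descW h; apply: descends_preserves.
exact: gha_stable_descends.
Qed.
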